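(* Let $\lambda\in k$ with $\lambda\neq 0$. (i) Let $(A,\succ,\prec,\Delta_{\succ,r},\Delta_{\prec,r})$ be a factorizable anti-dendriform bialgebra with $r\in A\otimes A$. Then $(A,\succ,\prec,P,\omega)$ is a quadratic Rota-Baxter anti-dendriform algebra of weight $\lambda$, where $$\omega(x,y)=-\lambda\langle T_{r+\tau(r)}^{-1}(x),y\rangle,\qquad P(x)=T_{r}\,\omega^{\sharp}(x),\qquad \forall x,y\in A.$$ (ii) Conversely, let $(A,\succ,\prec,P,\omega)$ be a quadratic Rota-Baxter anti-dendriform algebra of weight $\lambda$. Let $r\in A\otimes A$ be the element determined by $T_r=P(\omega^{\sharp})^{-1}$. Then $(A,\succ,\prec,\Delta_{\succ,r},\Delta_{\prec,r})$, with $$\Delta_{\succ,r}(x)=-(R_{\prec}(x)\otimes I+I\otimes L_{\cdot}(x))r,\qquad \Delta_{\prec,r}(x)=(R_{\cdot}(x)\otimes I+I\otimes L_{\succ}(x))r,$$ is a factorizable anti-dendriform bialgebra.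
   Context: All vector spaces are finite-dimensional over a field $k$. An anti-dendriform algebra is a vector space $A$ with bilinear operations $\succ,\prec$ such that, writing $x\cdot y=x\succ y+x\prec y$, for all $x,y,z$: $x\succ(y\succ z)=-(x\cdot y)\succ z=-x\prec(y\cdot z)=(x\prec y)\prec z$ and $(x\succ y)\prec z=x\succ(y\prec z)$; then $(A,\cdot)$ is associative. For $\ast\in\{\succ,\prec,\cdot\}$: $L_\ast(x)y=x\ast y$, $R_\ast(x)y=y\ast x$. $\tau$ is the flip; $I$ is the identity. For $r\in A\otimes A$, $T_r:A^*\to A$ is defined by $\langle T_r(\zeta),\eta\rangle=\langle r,\zeta\otimes\eta\rangle$. For a non-degenerate bilinear form $\omega$ on $A$, $\omega^\sharp:A\to A^*$ is $\langle\omega^\sharp(x),y\rangle=\omega(x,y)$. Invariance: $s\in A\otimes A$ is invariant if $(R_{\prec}(x)\otimes I+I\otimes L_{\cdot}(x))s=0$ and $(R_{\cdot}(x)\otimes I+I\otimes L_{\succ}(x))s=0$ for all $x\in A$. AD-YBE: for $r=\sum_i a_i\otimes b_i$, $\sum_{i,j}\big(a_i\cdot a_j\otimes b_i\otimes b_j+a_j\otimes (a_i\succ b_j)\otimes b_i-a_i\otimes a_j\otimes (b_i\prec b_j)\big)=0$. Anti-dendriform bialgebra: a quintuple $(A,\succ,\prec,\Delta_\succ,\Delta_\prec)$ where $(A,\succ,\prec)$ is an anti-dendriform algebra; $\Delta_\succ,\Delta_\prec:A\to A\otimes A$ are linear maps such that the operations on $A^*$ given by $\langle x,\zeta\succ_{A^*}\eta\rangle=\langle\Delta_\succ(x),\zeta\otimes\eta\rangle$,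 $\langle x,\zeta\prec_{A^*}\eta\rangle=\langle\Delta_\prec(x),\zeta\otimes\eta\rangle$ make $A^*$ an anti-dendriform algebra; and, with $\Delta=\Delta_\succ+\Delta_\prec$, for all $x,y\in A$: (1) $\Delta_{\prec}(x\cdot y)=(R_{\cdot}(y)\otimes I)\Delta_{\prec}(x)-(I\otimes L_{\succ}(x))\Delta_{\prec}(y)$; (2) $\Delta_{\succ}(x\cdot y)=(I\otimes L_{\cdot}(x))\Delta_{\succ}(y)-(R_{\prec}(y)\otimes I)\Delta_{\succ}(x)$; (3) $\Delta(x\prec y)=(R_{\prec}(y)\otimes I)\Delta(x)-(I\otimes L_{\prec}(x))\Delta_{\succ}(y)$; (4) $\Delta(x\succ y)=(I\otimes L_{\succ}(x))\Delta(y)-(R_{\succ}(y)\otimes I)\Delta_{\prec}(x)$; (5) $(L_{\succ}(x)\otimes I)\Delta(y)+(R_{\succ}(y)\otimes I)\tau\Delta_{\succ}(x)-(I\otimes L_{\prec}(y))\tau\Delta_{\prec}(x)-(I\otimes R_{\prec}(x))\Delta(y)=0$; (6) $(I\otimes R_{\cdot}(y))\Delta_{\succ}(x)+(L_{\succ}(y)\otimes I)\Delta_{\succ}(x)-\tau(I\otimes R_{\prec}(x))\Delta_{\prec}(y)-\tau(L_{\cdot}(x)\otimes I)\Delta_{\prec}(y)=0$. If $r$ solves the AD-YBE and $r+\tau(r)$ is invariant, the anti-dendriform bialgebra $(A,\succ,\prec,\Delta_{\succ,r},\Delta_{\prec,r})$ (with the formulas displayed in (ii)) is called quasi-triangular;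 it is factorizable if moreover $T_{r+\tau(r)}:A^*\to A$ is a linear isomorphism. A quadratic anti-dendriform algebra $(A,\succ,\prec,\omega)$ is an anti-dendriform algebra with a non-degenerate symmetric bilinear form $\omega$ with $\omega(x\succ y,z)=-\omega(y,z\cdot x)$ and $\omega(x\prec y,z)=-\omega(x,y\cdot z)$. A Rota-Baxter anti-dendriform algebra of weight $\lambda$ is $(A,\succ,\prec,P)$ with $P:A\to A$ linear and $P(x)\ast P(y)=P(P(x)\ast y+x\ast P(y)+\lambda x\ast y)$ for $\ast\in\{\succ,\prec\}$. $(A,\succ,\prec,P,\omega)$ is a quadratic Rota-Baxter anti-dendriform algebra of weight $\lambda$ if both hold and $\omega(P(x),y)+\omega(x,P(y))+\lambda\omega(x,y)=0$ for all $x,y$. *)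

(* Defs.v *)
From HB Require Import structures.
From mathcomp Require Import all_boot all_algebra.

Set Implicit Arguments.
Unset Strict Implicit.
Unset Printing Implicit Defensive.

Import GRing.Theory.
Local Open Scope ring_scope.

Definition dual (k : fieldType) (V : vectType k) : vectType k := 'Hom(V, k^o).

(* U (x) V is the space of coordinate matrices with respect to the bases
   vbasis {:U} and vbasis {:V}. Everything below is defined through tlift, the
   linear extension of a bilinear map; tens_bilinear, tlift_tens and
   tlift_unique are the universal property of the tensor product. *)
Definition tensor (k : fieldType) (U V : vectType k) : vectType k :=
  'M[k]_(\dim {:U}, \dim {:V}).

Section Tensor.
Variable k : fieldType.
Implicit Types U V W A : vectType k.

Definition tens U V (u : U) (v : V) : tensor U V :=
  \matrix_(i, j) (coord (vbasis {:U}) i u * coord (vbasis {:V}) j v).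

Definition tlift U V (W : lmodType k) (f : U -> V -> W) (r : tensor U V) : W :=
  \sum_i \sum_j r i j *: f (vbasis {:U})`_i (vbasis {:V})`_j.

(* f (x) g, for linear f and g: see tmap_tens. *)
Definition tmap U V U' V' (f : U -> U') (g : V -> V') :
    tensor U V -> tensor U' V' :=
  tlift (fun u v => tens (f u) (g v)).

Definition flip U V : tensor U V -> tensor V U := tlift (fun u v => tens v u).

(* < r, zeta (x) eta > *)
Definition tpair U V (r : tensor U V) (zeta : dual U) (eta : dual V) : k :=
  tlift (fun u v => (zeta u * eta v : k^o)) r.

(* T_r, which is characterized by TmapP below *)
Definition Tmap A (r : tensor A A) : 'Hom(dual A, A) :=
  linfun (fun zeta : dual A => tlift (fun u v => zeta u *: v) r).

Lemma tens_bilinear U V : bilinear_for *:%R *:%R (@tens U V).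
Proof.
split=> [v a u u'|u a v v']; apply/matrixP=> i j; rewrite !mxE linearP /=.
  by rewrite mulrDl -mulrA.
by rewrite mulrDr mulrCA.
Qed.

Lemma tlift_linear U V (W : lmodType k) (f : U -> V -> W) : linear (tlift f).
Proof.
move=> a r s; rewrite /tlift scaler_sumr -big_split; apply: eq_bigr => i _ /=.
rewrite scaler_sumr -big_split; apply: eq_bigr => j _ /=.
by rewrite !mxE scalerDl scalerA.
Qed.

HB.instance Definition _ U V (W : lmodType k) (f : U -> V -> W) :=
  GRing.isLinear.Build k (tensor U V) W *:%R (tlift f) (tlift_linear f).

Lemma bilinear_sum U V (W : lmodType k) (f : U -> V -> W) u v :
    bilinear_for *:%R *:%R f ->
  f u v = \sum_i \sum_j
    (coord (vbasis {:U}) i u * coord (vbasis {:V}) j v) *: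
      f (vbasis {:U})`_i (vbasis {:V})`_j.
Proof.
move=> [fl fr].
pose gl v' := GRing.isLinear.Build k U W *:%R (f^~ v') (fl v').
pose Fl v' : {linear U -> W} := HB.pack (f^~ v') (gl v').
pose gr u' := GRing.isLinear.Build k V W *:%R (f u') (fr u').
pose Fr u' : {linear V -> W} := HB.pack (f u') (gr u').
rewrite {1}(coord_vbasis (memvf u)) -[f _ v]/(Fl v _) linear_sum /=.
apply: eq_bigr => i _; rewrite -[f _ v]/(Fl v _) linearZ /=.
rewrite {1}(coord_vbasis (memvf v)) -[f _ _]/(Fr _ _) linear_sum /=.
rewrite scaler_sumr; apply: eq_bigr => j _.
by rewrite -[f _ _]/(Fr _ _) linearZ /= scalerA.
Qed.

Lemma tlift_tens U V (W : lmodType k) (f : U -> V -> W) u v :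
  bilinear_for *:%R *:%R f -> tlift f (tens u v) = f u v.
Proof.
move=> fB; rewrite [RHS]bilinear_sum //; apply: eq_bigr => i _.
by apply: eq_bigr => j _; rewrite mxE.
Qed.

Lemma tmap_tens U V U' V' (f : {linear U -> U'}) (g : {linear V -> V'}) u v :
  tmap f g (tens u v) = tens (f u) (g v).
Proof.
have [tl tr] := tens_bilinear U' V'.
by apply: tlift_tens; split=> [y a x x'|x a y y']; rewrite linearP ?tl ?tr.
Qed.

Lemma flip_tens U V (u : U) (v : V) : flip (tens u v) = tens v u.
Proof.
have [tl tr] := tens_bilinear V U.
by apply: tlift_tens; split=> [y a x x'|x a y y']; rewrite ?tl ?tr.
Qed.

Lemma tpair_tens U V (u : U) (v : V) (zeta : dual U) (eta : dual V) :
  tpair (tens u v) zeta eta = zeta u * eta v.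
Proof.
apply: (@tlift_tens U V k^o); split=> [y a x x'|x a y y']; rewrite linearP /=.
  by rewrite mulrDl -mulrA.
by rewrite mulrDr mulrCA.
Qed.

Lemma tens_vbasis U V (i : 'I_(\dim {:U})) (j : 'I_(\dim {:V})) :
  tens (vbasis {:U})`_i (vbasis {:V})`_j = delta_mx i j :> 'M_(_, _).
Proof.
apply/matrixP=> i' j'; rewrite !mxE !coord_free ?(basis_free (vbasisP _)) //.
by rewrite -natrM mulnb ![_ == i]eq_sym ![_ == j]eq_sym.
Qed.

Lemma tens_sum U V (r : tensor U V) :
  r = \sum_i \sum_j r i j *: tens (vbasis {:U})`_i (vbasis {:V})`_j.
Proof.
rewrite [LHS]matrix_sum_delta; apply: eq_bigr => i _; apply: eq_bigr => j _.
by rewrite -tens_vbasis.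
Qed.

Lemma tlift_unique U V (W : lmodType k) (f : U -> V -> W)
    (F : {linear tensor U V -> W}) :
  (forall u v, F (tens u v) = f u v) -> F =1 tlift f.
Proof.
move=> FE r; rewrite {1}(tens_sum r) linear_sum; apply: eq_bigr => i _ /=.
by rewrite linear_sum; apply: eq_bigr => j _ /=; rewrite linearZ /= FE.
Qed.

Lemma tens_seq U V (r : tensor U V) :
  exists s : seq (U * V), r = \sum_(p <- s) tens p.1 p.2.
Proof.
pose e (ij : 'I_(\dim {:U}) * 'I_(\dim {:V})) :=
  (r ij.1 ij.2 *: (vbasis {:U})`_ij.1, (vbasis {:V})`_ij.2).
exists [seq e ij | ij <- index_enum _]; rewrite big_map.
rewrite {1}(tens_sum r) pair_bigA; apply: eq_bigr => ij _ /=.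
by apply/matrixP=> i j; rewrite !mxE linearZ /= !mulrA.
Qed.

Lemma TmapE A (r : tensor A A) (zeta : dual A) :
  Tmap r zeta = tlift (fun u v => zeta u *: v) r.
Proof.
pose F (z : dual A) := tlift (fun u v : A => z u *: v) r.
have Flin : linear F.
  move=> a z z'; rewrite /F /tlift scaler_sumr -big_split.
  apply: eq_bigr => i _ /=; rewrite scaler_sumr -big_split.
  apply: eq_bigr => j _ /=.
  rewrite add_lfunE scale_lfunE scalerDl scalerDr !scalerA; congr (_ *: _ + _).
  by rewrite mulrCA mulrA.
pose Fm := GRing.isLinear.Build k (dual A) A *:%R F Flin.
pose FL : {linear dual A -> A} := HB.pack F Fm.
exact: (lfunE FL).
Qed.

Lemma TmapP A (r : tensor A A) (zeta eta : dual A) :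
  eta (Tmap r zeta) = tpair r zeta eta.
Proof.
rewrite TmapE /tpair /tlift linear_sum; apply: eq_bigr => i _.
rewrite linear_sum; apply: eq_bigr => j _ /=.
by rewrite [LHS]linearZ /=; congr (_ *: _); exact: linearZ.
Qed.

Lemma Tmap_bij A : bijective (@Tmap A).
Proof.
pose c i : dual A := linfun (coord (vbasis {:A}) i : A -> k^o).
have xE i j : coord (vbasis {:A}) i (vbasis {:A})`_(j : 'I__) = (i == j)%:R.
  by rewrite coord_free ?(basis_free (vbasisP _)) // eq_sym.
have cE i j : c i (vbasis {:A})`_(j : 'I__) = (i == j)%:R.
  by rewrite lfunE /= xE.
pose S (f : 'Hom(dual A, A)) : tensor A A :=
  \matrix_(i, j) coord (vbasis {:A}) j (f (c i)).
exists S => [r|f].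
  apply/matrixP=> i j; rewrite mxE TmapE /tlift linear_sum (bigD1 i) //=.
  rewrite linear_sum (bigD1 j) //= 2!linearZ /= cE xE !eqxx !mulr1.
  rewrite !big1 ?addr0 // => [i' ne_i'|j' ne_j'].
    rewrite linear_sum big1 // => j' _.
    by rewrite 2!linearZ /= cE eq_sym (negPf ne_i') mul0r mulr0.
  by rewrite 2!linearZ /= xE eq_sym (negPf ne_j') !mulr0.
apply/lfunP=> zeta; rewrite TmapE /tlift.
have {2}-> : zeta = \sum_(i < \dim {:A}) zeta (vbasis {:A})`_i *: c i.
  apply/lfunP=> x; rewrite sum_lfunE {1}(coord_vbasis (memvf x)) linear_sum.
  apply: eq_bigr => i _; rewrite scale_lfunE linearZ lfunE /=.
  by rewrite -[_ *: _]/(_ * _) -[RHS]/(_ * _) mulrC.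
rewrite linear_sum; apply: eq_bigr => i _ /=.
rewrite linearZ /= {1}(coord_vbasis (memvf (f (c i)))) scaler_sumr.
by apply: eq_bigr => j _; rewrite mxE !scalerA mulrC.
Qed.

End Tensor.

Section AntiDendriform.
Variables (k : fieldType).

Section Algebra.
Variable (A : vectType k).
Implicit Types (succ prec : A -> A -> A) (r s : tensor A A).

Definition dotop succ prec (x y : A) : A := succ x y + prec x y.
Definition Lmul (op : A -> A -> A) (x : A) : A -> A := fun y => op x y.
Definition Rmul (op : A -> A -> A) (x : A) : A -> A := fun y => op y x.

Definition is_anti_dendriform succ prec : Prop :=
  let dot := dotop succ prec in
  [/\ bilinear_for *:%R *:%R succ,
      bilinear_for *:%R *:%R prec,
      (forall x y z,
         [/\ succ x (succ y z) = - succ (dot x y) z,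
             - succ (dot x y) z = - prec x (dot y z) &
             - prec x (dot y z) = prec (prec x y) z]) &
      (forall x y z, prec (succ x y) z = succ x (prec y z))].

Definition is_invariant succ prec s : Prop :=
  let dot := dotop succ prec in
  forall x,
    tmap (Rmul prec x) id s + tmap id (Lmul dot x) s = 0 /\
    tmap (Rmul dot x) id s + tmap id (Lmul succ x) s = 0.

(* For bilinear succ and prec the sum does not depend on the decomposition of r,
   and tens_seq provides one. *)
Definition AD_YBE succ prec r : Prop :=
  let dot := dotop succ prec in
  forall s : seq (A * A), r = \sum_(p <- s) tens p.1 p.2 ->
    \sum_(p <- s) \sum_(q <- s)
      (tens (dot p.1 q.1) (tens p.2 q.2)
       + tens q.1 (tens (succ p.1 q.2) p.2)
       - tens p.1 (tens q.1 (prec p.2 q.2))) = 0.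

(* The argument of linfun is linear when Delta is. *)
Definition dual_op (Delta : A -> tensor A A) (zeta eta : dual A) : dual A :=
  linfun (fun x => tpair (Delta x) zeta eta : k^o).

End Algebra.

Variable (A : vectType k).
Implicit Types (succ prec : A -> A -> A) (Dsucc Dprec : A -> tensor A A).
Implicit Types (r : tensor A A) (P : 'End(A)) (omega : A -> A -> k).

Record is_bialgebra succ prec Dsucc Dprec : Prop := IsBialgebra {
  bialg_alg : is_anti_dendriform succ prec;
  bialg_Dsucc_linear : linear Dsucc;
  bialg_Dprec_linear : linear Dprec;
  bialg_dual : is_anti_dendriform (dual_op Dsucc) (dual_op Dprec);
  bialg1 : let dot := dotop succ prec in forall x y,
    Dprec (dot x y) =
      tmap (Rmul dot y) id (Dprec x) - tmap id (Lmul succ x) (Dprec y);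
  bialg2 : let dot := dotop succ prec in forall x y,
    Dsucc (dot x y) =
      tmap id (Lmul dot x) (Dsucc y) - tmap (Rmul prec y) id (Dsucc x);
  bialg3 : let D x := Dsucc x + Dprec x in forall x y,
    D (prec x y) =
      tmap (Rmul prec y) id (D x) - tmap id (Lmul prec x) (Dsucc y);
  bialg4 : let D x := Dsucc x + Dprec x in forall x y,
    D (succ x y) =
      tmap id (Lmul succ x) (D y) - tmap (Rmul succ y) id (Dprec x);
  bialg5 : let D x := Dsucc x + Dprec x in forall x y,
    tmap (Lmul succ x) id (D y) + tmap (Rmul succ y) id (flip (Dsucc x))
    - tmap id (Lmul prec y) (flip (Dprec x)) - tmap id (Rmul prec x) (D y) = 0;
  bialg6 : let dot := dotop succ prec in forall x y,
    tmap id (Rmul dot y) (Dsucc x) + tmap (Lmul succ y) id (Dsucc x)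
    - flip (tmap id (Rmul prec x) (Dprec y))
    - flip (tmap (Lmul dot x) id (Dprec y)) = 0
}.

Definition Delta_succ succ prec r (x : A) : tensor A A :=
  - (tmap (Rmul prec x) id r + tmap id (Lmul (dotop succ prec) x) r).

Definition Delta_prec succ prec r (x : A) : tensor A A :=
  tmap (Rmul (dotop succ prec) x) id r + tmap id (Lmul succ x) r.

Definition is_quasi_triangular succ prec r : Prop :=
  [/\ is_bialgebra succ prec (Delta_succ succ prec r) (Delta_prec succ prec r),
      AD_YBE succ prec r &
      is_invariant succ prec (r + flip r)].

Definition is_factorizable succ prec r : Prop :=
  is_quasi_triangular succ prec r /\ bijective (Tmap (r + flip r)).

Definition is_quadratic succ prec omega : Prop :=
  let dot := dotop succ prec in
  [/\ is_anti_dendriform succ prec,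
      bilinear_for *%R *%R omega,
      (forall x, (forall y, omega x y = 0) -> x = 0),
      (forall x y, omega x y = omega y x) &
      forall x y z, omega (succ x y) z = - omega y (dot z x) /\
                    omega (prec x y) z = - omega x (dot y z)].

Definition is_rota_baxter (lambda : k) succ prec P : Prop :=
  let rota_baxter_for (op : A -> A -> A) := forall x y,
    op (P x) (P y) = P (op (P x) y + op x (P y) + lambda *: op x y) in
  [/\ is_anti_dendriform succ prec, rota_baxter_for succ & rota_baxter_for prec].

Definition is_quadratic_rota_baxter (lambda : k) succ prec P omega : Prop :=
  [/\ is_quadratic succ prec omega,
      is_rota_baxter lambda succ prec P &
      forall x y, omega (P x) y + omega x (P y) + lambda * omega x y = 0].

(* The arguments of linfun are linear when omega is bilinear. *)
Definition sharp omega : 'Hom(A, dual A) :=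
  linfun (fun x => linfun (omega x : A -> k^o) : dual A).

End AntiDendriform.

(* Main.v *)
(* A nondegenerate invariant form omega identifies a tensor r with the bilinear
   form (x, y) |-> omega (P x) y, where T_r = P o (omega^sharp)^-1, and turns
   each multiplication operator acting on a leg of r into its omega-adjoint.
   In this dictionary r + tau r = - lambda omega is the skewness of P,
   invariance of r + tau r is invariance of omega, the AD-YBE is the Rota-Baxter
   identity for prec (the one for succ follows by skewness), the dual products
   become P x * y + x * P y + lambda x * y, and the compatibility conditions
   (1)-(6) reduce to identities of A. *)
Require Import Defs.
From HB Require Import structures.
From mathcomp Require Import all_boot all_algebra.
From mathcomp Require Import ring.
Import GRing.Theory.
Local Open Scope ring_scope.

Set Implicit Arguments.
Unset Strict Implicit.
Unset Printing Implicit Defensive.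

(** * Pairing tensors with functionals *)

Section TensorPairing.
Variable k : fieldType.
Implicit Types U V W A : vectType k.

(** [linfun] computes only on functions carrying a linear structure; the proof [fl] is packed into
    one here. *)
Lemma linfunE U V (f : U -> V) x : linear f -> linfun f x = f x.
Proof.
move=> fl; pose fm := GRing.isLinear.Build k U V *:%R f fl.
pose fL : {linear U -> V} := HB.pack f fm.
exact: (lfunE fL).
Qed.

Lemma tpair_linear U V (zeta : dual U) (eta : dual V) :
  linear ((fun t => tpair t zeta eta) : tensor U V -> k^o).
Proof. by move=> a s t; rewrite /tpair linearP. Qed.

Lemma tpairD U V (s t : tensor U V) (zeta : dual U) (eta : dual V) :
  tpair (s + t) zeta eta = tpair s zeta eta + tpair t zeta eta.
Proof. by rewrite /tpair linearD. Qed.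

Lemma tpairN U V (t : tensor U V) (zeta : dual U) (eta : dual V) :
  tpair (- t) zeta eta = - tpair t zeta eta.
Proof. by rewrite /tpair linearN. Qed.

Lemma tpair0 U V (zeta : dual U) (eta : dual V) :
  tpair (0 : tensor U V) zeta eta = 0.
Proof. by rewrite /tpair linear0. Qed.

Lemma tpairZ U V a (t : tensor U V) (zeta : dual U) (eta : dual V) :
  tpair (a *: t) zeta eta = a * tpair t zeta eta.
Proof. by rewrite /tpair linearZ. Qed.

Lemma tpair_sum U V I (l : seq I) (F : I -> tensor U V)
    (zeta : dual U) (eta : dual V) :
  tpair (\sum_(i <- l) F i) zeta eta = \sum_(i <- l) tpair (F i) zeta eta.
Proof. by rewrite /tpair linear_sum. Qed.

(** Both sides expand over the same pairs of basis vectors with the same coefficients, so agreement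
    term by term is enough. *)
Lemma tpair_tlift U V U' V' (f : U -> V -> tensor U' V') (t : tensor U V)
    (zeta : dual U') (eta : dual V') (zeta' : dual U) (eta' : dual V) :
  (forall u v, tpair (f u v) zeta eta = zeta' u * eta' v) ->
  tpair (tlift f t) zeta eta = tpair t zeta' eta'.
Proof.
move=> fE; rewrite /tlift tpair_sum; apply: eq_bigr => i _.
by rewrite tpair_sum; apply: eq_bigr => j _; rewrite tpairZ fE.
Qed.

Lemma tpair_tmap U V U' V' (f : U -> U') (g : V -> V') (t : tensor U V)
    (zeta : dual U') (eta : dual V') (zeta' : dual U) (eta' : dual V) :
  (forall u, zeta (f u) = zeta' u) -> (forall v, eta (g v) = eta' v) ->
  tpair (tmap f g t) zeta eta = tpair t zeta' eta'.
Proof.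
by move=> fE gE; apply: tpair_tlift => u v; rewrite tpair_tens fE gE.
Qed.

Lemma tpair_flip U V (t : tensor U V) (zeta : dual V) (eta : dual U) :
  tpair (flip t) zeta eta = tpair t eta zeta.
Proof. by apply: tpair_tlift => u v; rewrite tpair_tens mulrC. Qed.

Lemma dual_coord V (i : 'I_(\dim {:V})) :
  exists zeta : dual V, forall v, zeta v = coord (vbasis {:V}) i v.
Proof.
by exists (linfun (coord (vbasis {:V}) i : V -> k^o)) => v; rewrite lfunE.
Qed.

(** Pairing with two coordinate functionals reads off one entry of the matrix [t]. *)
Lemma tpair_eq0 U V (t : tensor U V) :
  (forall zeta eta, tpair t zeta eta = 0) -> t = 0.
Proof.
move=> t0; apply/matrixP=> i j; rewrite mxE.
have [z zE] := dual_coord i; have [e eE] := dual_coord j.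
rewrite -[RHS](t0 z e) /tpair /tlift (bigD1 i) //= (bigD1 j) //=.
have bE W a b : coord (vbasis {:W}) a (vbasis {:W})`_(b : 'I__) = (b == a)%:R.
  by rewrite coord_free ?(basis_free (vbasisP _)).
rewrite zE eE !bE !eqxx mulr1 [_ *: 1]mulr1.
rewrite !big1 ?addr0 // => [i' ne_i'|j' ne_j'].
  by rewrite big1 // => j' _; rewrite zE bE (negPf ne_i') mul0r scaler0.
by rewrite eE bE (negPf ne_j') mulr0 scaler0.
Qed.

(** The product functional, packaged as an element of the dual so that it can be paired with the
    second leg of a nested triple tensor. *)
Definition dtens U V (zeta : dual U) (eta : dual V) : dual (tensor U V) :=
  linfun (fun t : tensor U V => tpair t zeta eta : k^o).

Lemma dtensE U V (zeta : dual U) (eta : dual V) t :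
  dtens zeta eta t = tpair t zeta eta.
Proof. exact: (linfunE t (tpair_linear zeta eta)). Qed.

(** Contracting the first leg with [zeta] leaves [c zeta], a tensor of two factors, to which
    [tpair_eq0] applies. A general functional [phi] on the last two legs then sees only
    [c zeta = 0]. *)
Lemma tpair_dtens_eq0 U V W (t : tensor U (tensor V W)) :
  (forall zeta eta theta, tpair t zeta (dtens eta theta) = 0) -> t = 0.
Proof.
pose c (zeta : dual U) := tlift (fun u (s : tensor V W) => zeta u *: s) t.
have cE zeta (phi : dual (tensor V W)) : phi (c zeta) = tpair t zeta phi.
  rewrite /c /tpair /tlift linear_sum; apply: eq_bigr => i _.
  rewrite linear_sum; apply: eq_bigr => j _ /=.
  by rewrite linearZ /= linearZ.
move=> t0; apply: tpair_eq0 => zeta phi; rewrite -cE.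
suff -> : c zeta = 0 by rewrite linear0.
by apply: tpair_eq0 => eta theta; rewrite -dtensE cE.
Qed.

Lemma dual_opE A (Delta : A -> tensor A A) (zeta eta : dual A) x :
  linear Delta -> dual_op Delta zeta eta x = tpair (Delta x) zeta eta.
Proof.
by move=> Dl; apply: linfunE => a u v; rewrite Dl tpair_linear.
Qed.

End TensorPairing.


(** * Computation rules for unbundled bilinear maps *)

Section Bilinear.
Variables (k : fieldType) (U V W : lmodType k) (f : U -> V -> W).
Hypothesis fB : bilinear_for *:%R *:%R f.

Lemma bilinearDl u u' v : f (u + u') v = f u v + f u' v.
Proof. by have /= := fB.1 v 1 u u'; rewrite !scale1r. Qed.

Lemma bilinearDr u v v' : f u (v + v') = f u v + f u v'.
Proof. by have /= := fB.2 u 1 v v'; rewrite !scale1r. Qed.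

Lemma bilinearZl a u v : f (a *: u) v = a *: f u v.
Proof.
have f0 : f 0 v = 0 by apply: (addrI (f 0 v)); rewrite -bilinearDl !addr0.
by have /= := fB.1 v a u 0; rewrite f0 !addr0.
Qed.

Lemma bilinearZr a u v : f u (a *: v) = a *: f u v.
Proof.
have f0 : f u 0 = 0 by apply: (addrI (f u 0)); rewrite -bilinearDr !addr0.
by have /= := fB.2 u a v 0; rewrite f0 !addr0.
Qed.

Lemma bilinearNl u v : f (- u) v = - f u v.
Proof. by rewrite -scaleN1r bilinearZl scaleN1r. Qed.

Lemma bilinearNr u v : f u (- v) = - f u v.
Proof. by rewrite -scaleN1r bilinearZr scaleN1r. Qed.

End Bilinear.

(** * The descendent products of a Rota-Baxter operator *)

Section Descent.
Variables (k : fieldType) (A : vectType k) (lambda : k) (P : 'End(A)).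
Implicit Types op succ prec : A -> A -> A.

(** The descendent product: the Rota-Baxter identity says exactly that [P] is multiplicative from
    [descent op] to [op]. *)
Definition descent op (x y : A) : A :=
  op (P x) y + op x (P y) + lambda *: op x y.

Let rota_baxter op := forall x y, op (P x) (P y) = P (descent op x y).

(* Both bracketings of a double descendent product have this shape, so every
   trilinear identity of A passes to the descendent products. *)
Let expand (f : A -> A -> A -> A) x y z : A :=
  (f (P x) (P y) z + f (P x) y (P z) + lambda *: f (P x) y z)
  + f x (P y) (P z)
  + (lambda *: f x (P y) z + lambda *: f x y (P z)
     + lambda *: (lambda *: f x y z)).

Let eq_expand f g x y z :
  (forall x y z, f x y z = g x y z) -> expand f x y z = expand g x y z.
Proof. by move=> fg; rewrite /expand !fg. Qed.

Let expandN f x y z :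
  - expand f x y z = expand (fun x y z => - f x y z) x y z.
Proof. by rewrite /expand !opprD !scalerN. Qed.

Let descent_r op1 op2 x y z :
  bilinear_for *:%R *:%R op1 -> rota_baxter op2 ->
  descent op1 x (descent op2 y z) = expand (fun x y z => op1 x (op2 y z)) x y z.
Proof.
(* One term contains [P] of the inner product; the Rota-Baxter identity of [op2] turns it into
   [op2 (P y) (P z)], and the rest is distributivity. *)
move=> op1B rb2; rewrite {1}/descent -rb2 /descent !(bilinearDr op1B).
by rewrite !(bilinearZr op1B) !scalerDr.
Qed.

Let descent_l op1 op2 x y z :
  bilinear_for *:%R *:%R op1 -> rota_baxter op2 ->
  descent op1 (descent op2 x y) z = expand (fun x y z => op1 (op2 x y) z) x y z.
Proof.
move=> op1B rb2; rewrite {1}/descent -rb2 /descent !(bilinearDl op1B).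
rewrite !(bilinearZl op1B) !scalerDr /expand.
by rewrite !addrA [LHS](ACl (1*2*5*3*6*4*7)).
Qed.

Let descent_bilinear op :
  bilinear_for *:%R *:%R op -> bilinear_for *:%R *:%R (descent op).
Proof.
move=> opB; split=> [y a x x'|x a y y'] /=; rewrite /descent !linearP /=.
  rewrite !(bilinearDl opB) !(bilinearZl opB) !scalerDr !scalerA.
  by rewrite (mulrC lambda) !addrA [LHS](ACl (1*3*5*2*4*6)).
rewrite !(bilinearDr opB) !(bilinearZr opB) !scalerDr !scalerA.
by rewrite (mulrC lambda) !addrA [LHS](ACl (1*3*5*2*4*6)).
Qed.

Lemma descent_dotop succ prec x y :
  dotop (descent succ) (descent prec) x y = descent (dotop succ prec) x y.
Proof.
rewrite /dotop /descent scalerDr.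
by rewrite !addrA [LHS](ACl (1*4*2*5*3*6)).
Qed.

Lemma descent_anti_dendriform succ prec :
  is_rota_baxter lambda succ prec P ->
  is_anti_dendriform (descent succ) (descent prec).
Proof.
case=> -[sB pB ax1 ax2] rbs rbp.
(* The axioms also involve the sum of the two operations, which inherits the identity by linearity
   of [P]. *)
have rbd : rota_baxter (dotop succ prec).
  by move=> x y; rewrite /dotop rbs rbp -linearD -descent_dotop.
split=> [||x y z|x y z]; try exact: descent_bilinear.
  rewrite !descent_dotop !descent_r // !descent_l // !expandN.
  by split; apply: eq_expand => {}x {}y {}z; have [] := ax1 x y z.
by rewrite descent_r // descent_l //; apply: eq_expand.
Qed.

End Descent.

(** * Transport of the structure along a surjection *)

Section Transport.
Variables (k : fieldType) (A B : vectType k) (succ prec : A -> A -> A).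

Lemma dotop_bilinear :
  bilinear_for *:%R *:%R succ -> bilinear_for *:%R *:%R prec ->
  bilinear_for *:%R *:%R (dotop succ prec).
Proof.
move=> sB pB; split=> [y a x x'|x a y y'] /=; rewrite /dotop.
  rewrite !(bilinearDl sB) !(bilinearDl pB) !(bilinearZl sB) !(bilinearZl pB).
  by rewrite scalerDr addrACA.
rewrite !(bilinearDr sB) !(bilinearDr pB) !(bilinearZr sB) !(bilinearZr pB).
by rewrite scalerDr addrACA.
Qed.

(** Every element of [B] is a value of [phi], so each law of [B], bilinearity included, is the image
    of the same law in [A]. *)
Lemma anti_dendriform_transport (phi : 'Hom(A, B)) (succ' prec' : B -> B -> B) :
  (forall b, exists x, phi x = b) ->
  (forall x y, succ' (phi x) (phi y) = phi (succ x y)) ->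
  (forall x y, prec' (phi x) (phi y) = phi (prec x y)) ->
  is_anti_dendriform succ prec -> is_anti_dendriform succ' prec'.
Proof.
move=> phi_onto sE pE [sB pB ax1 ax2].
have dE x y : dotop succ' prec' (phi x) (phi y) = phi (dotop succ prec x y).
  by rewrite /dotop sE pE linearD.
have transB op (op' : B -> B -> B) :
    (forall x y, op' (phi x) (phi y) = phi (op x y)) ->
    bilinear_for *:%R *:%R op -> bilinear_for *:%R *:%R op'.
  move=> opE opB; split=> b a b1 b2; have [x <-] := phi_onto b;
  have [x1 <-] := phi_onto b1; have [x2 <-] := phi_onto b2 => /=.
    by rewrite !opE -!linearP opE (bilinearDl opB) (bilinearZl opB).
  by rewrite !opE -!linearP opE (bilinearDr opB) (bilinearZr opB).
split=> [||b1 b2 b3|b1 b2 b3]; try exact: transB.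
  have [x <-] := phi_onto b1; have [y <-] := phi_onto b2.
  have [z <-] := phi_onto b3; have [e1 e2 e3] := ax1 x y z.
  rewrite !(sE, pE, dE) -!linearN.
  by split; congr (phi _).
have [x <-] := phi_onto b1; have [y <-] := phi_onto b2.
by have [z <-] := phi_onto b3; rewrite !(sE, pE) ax2.
Qed.

End Transport.

(** * Tensors read as bilinear forms through [omega] *)

Section Form.
Variables (k : fieldType) (A : vectType k) (omega : A -> A -> k).
Hypothesis omegaB : bilinear_for *%R *%R omega.

(** A scalar form is a bilinear map into [k^o], where scaling is multiplication; the general rules
    are specialized that way. *)
Lemma formDl x x' y : omega (x + x') y = omega x y + omega x' y.
Proof. exact: (@bilinearDl k A A k^o omega omegaB). Qed.

Lemma formDr x y y' : omega x (y + y') = omega x y + omega x y'.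
Proof. exact: (@bilinearDr k A A k^o omega omegaB). Qed.

Lemma formZl a x y : omega (a *: x) y = a * omega x y.
Proof. exact: (@bilinearZl k A A k^o omega omegaB). Qed.

Lemma formZr a x y : omega x (a *: y) = a * omega x y.
Proof. exact: (@bilinearZr k A A k^o omega omegaB). Qed.

Lemma formNl x y : omega (- x) y = - omega x y.
Proof. exact: (@bilinearNl k A A k^o omega omegaB). Qed.

Lemma formNr x y : omega x (- y) = - omega x y.
Proof. exact: (@bilinearNr k A A k^o omega omegaB). Qed.

Lemma sharpE x y : sharp omega x y = omega x y.
Proof.
have omega_linear u : linear (omega u : A -> k^o).
  by move=> a v w; rewrite formDr formZr.
rewrite /sharp linfunE ?linfunE // => a u v; apply/lfunP => z.
by rewrite add_lfunE scale_lfunE !linfunE // formDl formZl.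
Qed.

Hypothesis omega_nd : forall x, (forall y, omega x y = 0) -> x = 0.

Lemma sharp_ker0 : lker (sharp omega) == 0%VS.
Proof.
apply/eqP/vspaceP => x; rewrite memv_ker memv0; apply/eqP/eqP => [x0|->].
  by apply: omega_nd => y; rewrite -sharpE x0 zero_lfunE.
exact: linear0.
Qed.

Lemma sharp_onto (zeta : dual A) : exists x, sharp omega x = zeta.
Proof.
have /eqP limgT : limg (sharp omega) == fullv.
  (* Injectivity suffices, as the dimensions agree: [dual A] is a space of maps into [k^o], of
     dimension [dim A * 1]. *)
  rewrite eqEdim subvf limg_dim_eq ?(eqP sharp_ker0) ?capv0 //.
  by rewrite !dimvf -[dim (dual A)]/(dim A * 1)%N muln1 leqnn.
have /memv_imgP[x _ ->] : zeta \in limg (sharp omega) by rewrite limgT memvf.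
by exists x.
Qed.

Definition tform (t : tensor A A) (x y : A) : k :=
  tpair t (sharp omega x) (sharp omega y).

Lemma tform_eq (s t : tensor A A) :
  (forall x y, tform s x y = tform t x y) -> s = t.
Proof.
move=> st; apply/eqP; rewrite -subr_eq0; apply/eqP/tpair_eq0 => zeta eta.
have [x <-] := sharp_onto zeta; have [y <-] := sharp_onto eta.
by rewrite tpairD tpairN; apply/eqP; rewrite subr_eq0; apply/eqP/st.
Qed.

Lemma tformD s t x y : tform (s + t) x y = tform s x y + tform t x y.
Proof. exact: tpairD. Qed.

Lemma tformN t x y : tform (- t) x y = - tform t x y.
Proof. exact: tpairN. Qed.

Lemma tform0 x y : tform 0 x y = 0.
Proof. exact: tpair0. Qed.

Lemma tformZ a t x y : tform (a *: t) x y = a * tform t x y.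
Proof. exact: tpairZ. Qed.

Lemma tform_flip t x y : tform (flip t) x y = tform t y x.
Proof. exact: tpair_flip. Qed.

Lemma tform_Tmap t x y : tform t x y = omega y (Tmap t (sharp omega x)).
Proof. by rewrite -sharpE TmapP. Qed.

Lemma tform_seq (l : seq (A * A)) x y :
  tform (\sum_(p <- l) tens p.1 p.2) x y =
  \sum_(p <- l) omega x p.1 * omega y p.2.
Proof.
rewrite /tform tpair_sum.
by under eq_bigr do rewrite tpair_tens !sharpE.
Qed.

Lemma tform_tmap (f g f' g' : A -> A) t x y :
  (forall a u, omega u (f a) = omega (f' u) a) ->
  (forall a u, omega u (g a) = omega (g' u) a) ->
  tform (tmap f g t) x y = tform t (f' x) (g' y).
Proof. by move=> fE gE; apply: tpair_tmap => u; rewrite !sharpE. Qed.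

Lemma tform_bilinear t : bilinear_for *%R *%R (tform t).
Proof.
have [l ->] := tens_seq t.
split=> [y a x x'|x a y y'] /=; rewrite !tform_seq mulr_sumr -big_split;
  by apply: eq_bigr => p _ /=; rewrite formDl formZl; ring.
Qed.

End Form.

(** * Adjoints of the multiplication operators in a quadratic algebra *)

Section Quadratic.
Variables (k : fieldType) (A : vectType k).
Variables (succ prec : A -> A -> A) (omega : A -> A -> k).
Hypothesis quad : is_quadratic succ prec omega.

Local Notation dot := (dotop succ prec).
Local Notation "x >- y" := (succ x y) (at level 40, left associativity).
Local Notation "x -< y" := (prec x y) (at level 40, left associativity).
Local Notation "x ** y" := (dot x y) (at level 40, left associativity).

Let alg : is_anti_dendriform succ prec. Proof. by case: quad. Qed.
Let omegaB : bilinear_for *%R *%R omega. Proof. by case: quad. Qed.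
Let omega_nd x : (forall y, omega x y = 0) -> x = 0.
Proof. by case: quad => _ _ nd _ _; apply: nd. Qed.
Let omegaC x y : omega x y = omega y x. Proof. by case: quad. Qed.
Let omega_succ x y z : omega (x >- y) z = - omega y (z ** x).
Proof. by case: quad => _ _ _ _ /(_ x y z)[]. Qed.
Let omega_prec x y z : omega (x -< y) z = - omega x (y ** z).
Proof. by case: quad => _ _ _ _ /(_ x y z)[]. Qed.
Let succB : bilinear_for *:%R *:%R succ. Proof. by case: alg. Qed.
Let precB : bilinear_for *:%R *:%R prec. Proof. by case: alg. Qed.

Let sDl := bilinearDl succB. Let sDr := bilinearDr succB.
Let sNl := bilinearNl succB. Let sNr := bilinearNr succB.
Let pDl := bilinearDl precB. Let pDr := bilinearDr precB.
Let pNl := bilinearNl precB. Let pNr := bilinearNr precB.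
Let sZl := bilinearZl succB. Let sZr := bilinearZr succB.
Let pZr := bilinearZr precB.
Let oDl := formDl omegaB. Let oDr := formDr omegaB.
Let oNl := formNl omegaB. Let oNr := formNr omegaB.
Let oZl := formZl omegaB. Let oZr := formZr omegaB.

(** Both sides equal [- omega y (z ** x)] by the two invariance laws. *)
Lemma omega_cycle x y z : omega (x >- y) z = omega (y -< z) x.
Proof. by rewrite omega_succ omega_prec. Qed.

Definition adjoint (f f' : A -> A) :=
  forall a u, omega u (f a) = omega (f' u) a.

Lemma adjoint_Rprec x : adjoint (Rmul prec x) (fun u => - (x ** u)).
Proof. by move=> a u; rewrite /Rmul omegaC omega_prec oNl omegaC. Qed.

Lemma adjoint_Lsucc x : adjoint (Lmul succ x) (fun u => - (u ** x)).
Proof. by move=> a u; rewrite /Lmul omegaC omega_succ oNl omegaC. Qed.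

Lemma adjoint_Rsucc x : adjoint (Rmul succ x) (fun u => x -< u).
Proof. by move=> a u; rewrite /Rmul omegaC omega_cycle. Qed.

Lemma adjoint_Lprec x : adjoint (Lmul prec x) (fun u => u >- x).
Proof. by move=> a u; rewrite /Lmul omegaC -omega_cycle. Qed.

(** The contribution [x -< u] of [adjoint_Rsucc] cancels the [prec] half of [- (x ** u)]; the same
    cancellation, mirrored, gives [adjoint_Ldot]. *)
Lemma adjoint_Rdot x : adjoint (Rmul dot x) (fun u => - (x >- u)).
Proof.
move=> a u; rewrite /Rmul {1}/dotop oDr adjoint_Rsucc adjoint_Rprec /dotop.
by rewrite !oNl oDl; ring.
Qed.

Lemma adjoint_Ldot x : adjoint (Lmul dot x) (fun u => - (u -< x)).
Proof.
move=> a u; rewrite /Lmul {1}/dotop oDr adjoint_Lsucc adjoint_Lprec /dotop.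
by rewrite !oNl oDl; ring.
Qed.

Local Notation tform := (tform omega).

Let tform_left (f f' : A -> A) t x y (adj : adjoint f f') :
  tform (tmap f id t) x y = tform t (f' x) y.
Proof. exact: tform_tmap. Qed.

Let tform_right (g g' : A -> A) t x y (adj : adjoint g g') :
  tform (tmap id g t) x y = tform t x (g' y).
Proof. exact: tform_tmap. Qed.

Lemma sharp_bijective : bijective (sharp omega).
Proof.
have ker0 := sharp_ker0 omegaB omega_nd.
exists ((sharp omega)^-1)%VF => [|zeta]; first exact: lker0_lfunK.
by have [x <-] := sharp_onto omegaB omega_nd zeta; rewrite lker0_lfunK.
Qed.

(** * The dictionary between [r] and the operator [P] *)

Section RotaBaxter.
Variables (lambda : k) (P : 'End(A)) (r : tensor A A).
Hypothesis P_skew : forall x y,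
  omega (P x) y + omega x (P y) + lambda * omega x y = 0.
Hypothesis rE : forall x, Tmap r (sharp omega x) = P x.

Lemma tform_r x y : tform r x y = omega (P x) y.
Proof. by rewrite tform_Tmap // rE omegaC. Qed.

(** Skewness of weight [lambda], restated: the adjoint of [P] is [- lambda - P]. *)
Lemma P_adjoint x y : omega (P x) y = omega x (- lambda *: y - P y).
Proof.
rewrite oDr oNr oZr; apply/eqP; rewrite -subr_eq0 -(P_skew x y); apply/eqP.
by ring.
Qed.

Lemma omegaP x y : omega x (P y) = - lambda * omega x y - omega (P x) y.
Proof. by rewrite P_adjoint oDr oNr oZr; ring. Qed.

Lemma tform_sym x y : tform (r + flip r) x y = - lambda * omega x y.
Proof.
rewrite tformD tform_flip !tform_r P_adjoint oDr oNr oZr.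
by rewrite [omega (P y) x]omegaC; ring.
Qed.

Lemma invariant_sym : is_invariant succ prec (r + flip r).
Proof.
move=> x; split; apply: (tform_eq omegaB omega_nd) => u v.
  rewrite tform0 tformD (tform_left _ _ _ (adjoint_Rprec x)).
  rewrite (tform_right _ _ _ (adjoint_Ldot x)).
  by rewrite !tform_sym oNl oNr adjoint_Rprec oNl; ring.
rewrite tform0 tformD (tform_left _ _ _ (adjoint_Rdot x)).
rewrite (tform_right _ _ _ (adjoint_Lsucc x)).
by rewrite !tform_sym oNl oNr [omega u _]adjoint_Rdot oNl; ring.
Qed.

Let RB (op : A -> A -> A) :=
  forall x y, op (P x) (P y) = P (op (P x) y + op x (P y) + lambda *: op x y).

(** By [tform_sym], composing with [sharp omega] gives multiplication by [- lambda], so the inverse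
    is [sharp omega] scaled by [- lambda^-1]. *)
Lemma Tmap_sym_bijective : lambda != 0 -> bijective (Tmap (r + flip r)).
Proof.
move=> lambda0; have [f fK fK'] := sharp_bijective.
have TE x : Tmap (r + flip r) (sharp omega x) = - lambda *: x.
  apply/eqP; rewrite -subr_eq0; apply/eqP/omega_nd => y.
  rewrite omegaC oDr oNr oZr -tform_Tmap // tform_sym omegaC.
  by ring.
exists (fun x => sharp omega (- lambda^-1 *: x)) => [zeta|x].
  by rewrite -(fK' zeta) TE scalerA mulrNN mulVf // scale1r.
by rewrite TE scalerA mulrNN mulfV // scale1r.
Qed.

Lemma rota_baxter_succ : RB prec -> RB succ.
Proof.
move=> rbp x y; apply/eqP; rewrite -subr_eq0; apply/eqP/omega_nd => z.
(* The [prec] identity at [(y, z)], paired with [x], is the [succ] identity at [(x, y)] paired with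
   [z], after [omega_cycle] and moving [P] across [omega]. *)
have := congr1 (omega^~ x) (rbp y z); rewrite /= !linearD !linearZ /= => rbE.
rewrite !(oDl, oNl, oZl) !(P_adjoint (_ >- _)).
rewrite !(oDr, oNr, oZr) !omega_cycle !omegaP rbE !(oDl, oZl); ring.
Qed.

(** Each term contains two copies of [r]. Moving products across [omega] isolates the legs of one
    copy, so that [lE] contracts it and inserts a [P]; first the sum over [q] collapses ([E1], [E2],
    [E3]), then the sum over [p]. What remains is the Rota-Baxter defect of [prec]. *)
Lemma AD_YBE_form (l : seq (A * A)) u v w :
  r = \sum_(p <- l) tens p.1 p.2 ->
  tpair (\sum_(p <- l) \sum_(q <- l)
      (tens (p.1 ** q.1) (tens p.2 q.2)
       + tens q.1 (tens (p.1 >- q.2) p.2)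
       - tens p.1 (tens q.1 (p.2 -< q.2))))
    (sharp omega u) (dtens (sharp omega v) (sharp omega w))
  = omega (P (P u -< v + u -< P v + lambda *: (u -< v)) - P u -< P v) w.
Proof.
move=> rl.
have lE x y : \sum_(p <- l) omega x p.1 * omega y p.2 = omega (P x) y.
  by rewrite -tform_seq // -rl tform_r.
have E1 p : \sum_(q <- l) omega u (p.1 ** q.1) * (omega v p.2 * omega w q.2)
    = omega ((lambda *: w + P w) >- u) p.1 * omega v p.2.
  under eq_bigr do rewrite (adjoint_Ldot p.1) mulrCA.
  (* [P] has landed on a product containing [p.1]; it is moved onto [w], and cyclicity then frees
     [p.1] for the outer contraction. *)
  rewrite -mulr_sumr lE P_adjoint !(oDr, oNr, oZr, oNl) mulrC; congr (_ * _).
  by rewrite -!omega_cycle sDl sZl oDl oZl; ring.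
have E2 p : \sum_(q <- l) omega u q.1 * (omega v (p.1 >- q.2) * omega w p.2)
    = omega (P u -< v) p.1 * omega w p.2.
  under eq_bigr do rewrite (adjoint_Lsucc p.1) mulrA.
  by rewrite -mulr_suml lE oNr -omega_succ omega_cycle.
have E3 p : \sum_(q <- l) omega u p.1 * (omega v q.1 * omega w (p.2 -< q.2))
    = omega u p.1 * omega (- (P v ** w)) p.2.
  under eq_bigr do rewrite (adjoint_Lprec p.2).
  rewrite -mulr_sumr lE [omega (P v) _]omegaC /= omega_succ oNl.
  by rewrite [omega p.2 _]omegaC.
rewrite tpair_sum.
under eq_bigr => p _.
  rewrite tpair_sum.
  under eq_bigr do rewrite tpairD tpairN tpairD !tpair_tens !dtensE !tpair_tens
    !sharpE //.
  rewrite sumrB big_split /= E1 E2 E3; over.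
rewrite sumrB big_split /= !lE.
rewrite (P_adjoint (_ >- _)) omega_cycle [omega (P u) _]oNr -omega_prec.
rewrite !(oDr, oZr) omegaP !(pDr, pNr, pZr) !linearD !linearN !linearZ /=.
by rewrite !(oDl, oNl, oZl); ring.
Qed.

Local Notation Dsucc := (Delta_succ succ prec r).
Local Notation Dprec := (Delta_prec succ prec r).

Lemma tform_Dsucc x u v :
  tform (Dsucc x) u v = tform r (x ** u) v + tform r u (v -< x).
Proof.
rewrite tformN tformD (tform_left _ _ _ (adjoint_Rprec x)).
rewrite (tform_right _ _ _ (adjoint_Ldot x)) !tform_r linearN oNl oNr.
by rewrite opprD !opprK.
Qed.

Lemma tform_Dprec x u v :
  tform (Dprec x) u v = - tform r (x >- u) v - tform r u (v ** x).
Proof.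
rewrite tformD (tform_left _ _ _ (adjoint_Rdot x)).
by rewrite (tform_right _ _ _ (adjoint_Lsucc x)) !tform_r linearN oNl oNr.
Qed.

Let r_skew u v : tform r v u = - tform r u v - lambda * omega u v.
Proof.
by rewrite !tform_r omegaC omegaP; ring.
Qed.

(** Undoing the flip with [r_skew] creates two multiples of [lambda], which cancel by invariance of
    [omega]. All coproducts thus become values of [r] with [u] in the first argument and [v] in the
    second. *)
Lemma tform_flip_Dsucc x u v :
  tform (flip (Dsucc x)) u v = - tform r (u -< x) v - tform r u (x ** v).
Proof.
rewrite tform_flip tform_Dsucc [tform r (_ ** _) _]r_skew [tform r v _]r_skew.
by rewrite [omega (_ -< _) _]omega_prec; ring.
Qed.

Lemma tform_flip_Dprec x u v :
  tform (flip (Dprec x)) u v = tform r (u ** x) v + tform r u (x >- v).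
Proof.
rewrite tform_flip tform_Dprec [tform r (_ >- _) _]r_skew [tform r v _]r_skew.
by rewrite [omega u _]omegaC omega_succ [omega v _]omegaC; ring.
Qed.

Lemma Dsucc_descent x u v :
  tform (Dsucc x) u v = omega x (descent lambda P succ u v).
Proof.
rewrite tform_Dsucc !tform_r P_adjoint omegaC (adjoint_Rdot u) /=.
rewrite [omega x _]omegaC /descent !(sDr, sNr, sZr) !(oDl, oNl, oZl).
by rewrite [omega (P u >- v) x]omega_cycle [omega (P u) _]omegaC; ring.
Qed.

Lemma Dprec_descent x u v :
  tform (Dprec x) u v = omega x (descent lambda P prec u v).
Proof.
rewrite tform_Dprec !tform_r P_adjoint omega_cycle.
rewrite [omega x _]omegaC /descent !(pDr, pNr, pZr) !(oDl, oNl, oZl).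
by rewrite [omega (P u -< v) x]omega_prec; ring.
Qed.

Let rDl := formDl (tform_bilinear omegaB r).
Let rDr := formDr (tform_bilinear omegaB r).
Let rNl := formNl (tform_bilinear omegaB r).
Let rNr := formNr (tform_bilinear omegaB r).

(** Linearity is visible in [Dsucc_descent], where [x] is merely an argument of [omega]. *)
Lemma Dsucc_linear : linear Dsucc.
Proof.
move=> a x y; apply: (tform_eq omegaB omega_nd) => u v.
by rewrite [RHS]tformD [in RHS]tformZ !Dsucc_descent oDl oZl.
Qed.

Lemma Dprec_linear : linear Dprec.
Proof.
move=> a x y; apply: (tform_eq omegaB omega_nd) => u v.
by rewrite [RHS]tformD [in RHS]tformZ !Dprec_descent oDl oZl.
Qed.

(** This rule and the next three orient the axioms into a normal form: every triple product becomes
    a combination of [(x >- y) >- z], [(x -< y) >- z], [x >- (y -< z)] and [x -< (y -< z)]. *)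
Let succ_succ x y z : x >- (y >- z) = - ((x >- y) >- z) - (x -< y) >- z.
Proof. by case: alg => _ _ /(_ x y z)[-> _ _] _; rewrite sDl opprD. Qed.

Let prec_succ x y z :
  x -< (y >- z) = (x >- y) >- z + (x -< y) >- z - x -< (y -< z).
Proof.
case: alg => _ _ /(_ x y z)[_ /oppr_inj + _] _.
by rewrite sDl /dotop pDr => ->; rewrite addrK.
Qed.

Let prec_prec x y z : (x -< y) -< z = - ((x >- y) >- z) - (x -< y) >- z.
Proof.
by case: alg => _ _ /(_ x y z)[_ + <-] _ => <-; rewrite sDl opprD.
Qed.

Let succ_prec x y z : (x >- y) -< z = x >- (y -< z).
Proof. by case: alg. Qed.

Let formsL t x y u := (tform_left t x y (adjoint_Rprec u),
  tform_left t x y (adjoint_Lsucc u), tform_left t x y (adjoint_Rsucc u),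
  tform_left t x y (adjoint_Rdot u), tform_left t x y (adjoint_Ldot u)).
Let formsR t x y u := (tform_right t x y (adjoint_Rprec u),
  tform_right t x y (adjoint_Lsucc u), tform_right t x y (adjoint_Lprec u),
  tform_right t x y (adjoint_Rdot u), tform_right t x y (adjoint_Ldot u)).

(** The dual operations are the descendent products carried along [sharp omega]. The six
    compatibility conditions are tested against [u] and [v], which turns them into linear relations
    between values of [tform r]. *)
Lemma bialgebra : is_rota_baxter lambda succ prec P ->
  is_bialgebra succ prec Dsucc Dprec.
Proof.
move=> rb; split=> //; first exact: Dsucc_linear; first exact: Dprec_linear.
- apply: (anti_dendriform_transport (phi := sharp omega)
    (succ := descent lambda P succ) (prec := descent lambda P prec)).
  + exact: sharp_onto.
  + move=> x y; apply/lfunP=> z; rewrite dual_opE; last exact: Dsucc_linear.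
    by rewrite [RHS]sharpE // [RHS]omegaC -Dsucc_descent.
  + move=> x y; apply/lfunP=> z; rewrite dual_opE; last exact: Dprec_linear.
    by rewrite [RHS]sharpE // [RHS]omegaC -Dprec_descent.
  + exact: descent_anti_dendriform.
all: have := (tform_Dsucc, tform_Dprec, tform_flip_Dsucc, tform_flip_Dprec).
(* Generalized because tformD would match Delta_prec by unfolding it. *)
all: move: Dsucc Dprec => Ds Dp DE.
all: move=> D x y; apply: (tform_eq omegaB omega_nd) => u v.
all: rewrite {}/D /= ?(tformD, tformN, tform0).
(* In the sixth condition the flip is outermost: it is exchanged for swapped arguments so that the
   adjoints apply, and put back below to restore the order of [u] and [v]. *)
6: rewrite ![tform (flip _) u v]tform_flip.
all: rewrite ?(formsL, formsR).
6: rewrite -![tform (Dp y) _ _]tform_flip.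
all: rewrite ?(tformD, DE) /dotop.
(* Once all triple products are in normal form, equal values of [tform r] coincide syntactically and
   [ring] can treat them as atoms. *)
all: rewrite ?(sDl, sDr, pDl, pDr, sNl, sNr, pNl, pNr,
  succ_succ, prec_succ, prec_prec, succ_prec).
all: rewrite ?(rDl, rDr, rNl, rNr); ring.
Qed.

End RotaBaxter.
End Quadratic.

(** * The two directions of the correspondence *)

Section Factorizable.
Variables (k : fieldType) (A : vectType k) (succ prec : A -> A -> A).
Variables (lambda : k) (r : tensor A A).

Hypothesis lambda0 : lambda != 0.

Lemma factorizable_of_quadratic_rota_baxter
    (P : 'End(A)) (omega : A -> A -> k) :
  is_quadratic_rota_baxter lambda succ prec P omega ->
  Tmap r = (P \o (sharp omega)^-1)%VF -> is_factorizable succ prec r.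
Proof.
move=> [quad rb skew] rP.
have [_ omegaB omega_nd omegaC _] := quad.
have rE x : Tmap r (sharp omega x) = P x.
  by rewrite rP comp_lfunE lker0_lfunK // sharp_ker0.
split; last exact: (Tmap_sym_bijective quad skew rE lambda0).
split; first exact: (bialgebra quad skew rE rb);
  last exact: (invariant_sym quad skew rE).
(* The Yang-Baxter tensor is tested on product functionals, all of which come from elements of [A]
   through [sharp omega]. *)
move=> l rl; apply: tpair_dtens_eq0 => zeta eta theta.
have [u <-] := sharp_onto omegaB omega_nd zeta.
have [v <-] := sharp_onto omegaB omega_nd eta.
have [w <-] := sharp_onto omegaB omega_nd theta.
rewrite (AD_YBE_form quad skew rE) //; case: rb => _ _ ->.
by rewrite subrr -(subrr (0 : A)) formDl // formNl // subrr.
Qed.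

Hypothesis fact : is_factorizable succ prec r.

Let T := Tmap (r + flip r).
Let omega := fun x y : A => - lambda * (T^-1%VF x : dual A) y.
Let P : 'End(A) := (Tmap r \o sharp omega)%VF.

(** The formal inverse of a linear map is a left inverse when the kernel is trivial, which
    bijectivity provides. *)
Let TK : cancel T T^-1%VF.
Proof.
have [_ [g gK _]] := fact; apply: lker0_lfunK.
apply/eqP/vspaceP => x; rewrite memv_ker memv0.
apply/eqP/eqP => [Tx|->]; last exact: linear0.
by rewrite -[x]gK -/T Tx -(linear0 T) gK.
Qed.

Let TVK : cancel T^-1%VF T.
Proof.
by have [_ [g _ gK]] := fact; move=> x; rewrite -[x]gK -/T TK.
Qed.

Lemma quadratic_rota_baxter_of_factorizable :
  is_quadratic_rota_baxter lambda succ prec P omega.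
Proof.
have [[[alg _ _ _ _ _ _ _ _ _] ybe inv] _] := fact.
have omegaB : bilinear_for *%R *%R omega.
  split=> [y a x x'|x a y y'] /=; rewrite /omega linearP.
    by rewrite add_lfunE scale_lfunE mulrDr mulrCA.
  by rewrite mulrDr mulrCA.
have sharpT x : sharp omega x = - lambda *: T^-1%VF x.
  by apply/lfunP => y; rewrite sharpE // scale_lfunE.
have T_sharp x : T (sharp omega x) = - lambda *: x.
  by rewrite sharpT linearZ /= TVK.
have tpT zeta x : tpair (r + flip r) (sharp omega x) zeta = - lambda * zeta x.
  by rewrite -TmapP -/T T_sharp linearZ.
have tp_sym zeta eta :
    tpair (r + flip r) zeta eta = tpair (r + flip r) eta zeta.
  by rewrite !tpairD !tpair_flip addrC.
(* Multiplied by [- lambda], [omega x y] is a pairing with [r + flip r], so its symmetry is that of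
   this tensor. *)
have omegaC x y : omega x y = omega y x.
  apply: (mulfI (_ : - lambda != 0)); first by rewrite oppr_eq0.
  rewrite -[omega x y]sharpE // -[omega y x]sharpE //.
  by rewrite -[LHS]tpT tp_sym tpT.
have omega_nd x : (forall y, omega x y = 0) -> x = 0.
  move=> x0; rewrite -[x]TVK; suff -> : T^-1%VF x = 0 by rewrite linear0.
  apply/lfunP=> y; apply: (mulfI (_ : - lambda != 0)).
    by rewrite oppr_eq0.
  by rewrite [LHS]x0 zero_lfunE mulr0.
have [succB precB _ _] := alg.
have dotB := dotop_bilinear succB precB.
(* Adjoints with respect to [omega] presuppose its invariance, still to be shown here, so operators
   are transposed to plain functionals instead. *)
have omega_comp f u : linear f ->
    exists z : dual A, forall x, omega u (f x) = z x.
  move=> fl; exists (linfun (fun x => omega u (f x) : k^o)) => x.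
  by rewrite linfunE // => a y y'; rewrite fl formDr // formZr.
have ltp f u v : linear f ->
    tpair (tmap f id (r + flip r)) (sharp omega u) (sharp omega v) =
    - lambda * omega u (f v).
  move=> fl; have [z zE] := omega_comp f u fl.
  rewrite zE -tpT tp_sym; apply: tpair_tmap => // x.
  by rewrite sharpE // zE.
have rtp f u v : linear f ->
    tpair (tmap id f (r + flip r)) (sharp omega u) (sharp omega v) =
    - lambda * omega v (f u).
  move=> fl; have [z zE] := omega_comp f v fl.
  rewrite zE -tpT; apply: tpair_tmap => // x.
  by rewrite sharpE // zE.
have quad : is_quadratic succ prec omega.
  have neg a b : - lambda * a + - lambda * b = 0 -> b = - a.
    move=> /eqP; rewrite -mulrDr mulf_eq0 oppr_eq0 (negPf lambda0) /=.
    by rewrite addrC addr_eq0 => /eqP.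
  have Rlinear op x : bilinear_for *:%R *:%R op -> linear (Rmul op x : A -> A).
    by case=> opl _ a u v; apply: opl.
  have Llinear op x : bilinear_for *:%R *:%R op -> linear (Lmul op x : A -> A).
    by case=> _ opr a u v; apply: opr.
  (* The second invariance equation at [x] gives the law for [succ], the first one at [y] the law
     for [prec]. *)
  split=> // x y z; have [inv1 _] := inv y; have [_ inv2] := inv x.
  split; rewrite omegaC; apply: neg.
    rewrite -[omega y _]/(omega y (Rmul _ x z)) -ltp; last exact: Rlinear.
    rewrite -[omega z _]/(omega z (Lmul _ x y)) -rtp; last exact: Llinear.
    by rewrite -tpairD inv2 tpair0.
  rewrite addrC -[omega z _]/(omega z (Rmul _ y x)) -ltp; last exact: Rlinear.
  rewrite -[omega x _]/(omega x (Lmul _ y z)) -rtp; last exact: Llinear.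
  by rewrite -tpairD inv1 tpair0.
have skew x y : omega (P x) y + omega x (P y) + lambda * omega x y = 0.
  rewrite [omega (P x) y]omegaC /P !comp_lfunE -!tform_Tmap //.
  rewrite -[tform omega r y x]tform_flip -tformD /tform tpT sharpE // omegaC.
  by ring.
have rE x : Tmap r (sharp omega x) = P x by rewrite /P comp_lfunE.
have rbp x y : prec (P x) (P y) =
    P (prec (P x) y + prec x (P y) + lambda *: prec x y).
  (* By [AD_YBE_form] the defect of the identity paired with [z] is a value of the Yang-Baxter
     tensor; nondegeneracy concludes. *)
  have [l rl] := tens_seq r; apply/eqP; rewrite eq_sym -subr_eq0.
  apply/eqP/omega_nd => z; rewrite -(AD_YBE_form quad skew rE x y z rl).
  by rewrite (ybe l rl) tpair0.
split=> //; split=> //; exact: (rota_baxter_succ quad skew).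
Qed.

End Factorizable.

Theorem theorem6p12 (k : fieldType) (lambda : k) (A : vectType k)
    (succ prec : A -> A -> A) :
  lambda != 0 ->
  (forall r : tensor A A,
     is_factorizable succ prec r ->
     let omega := fun x y : A =>
       - lambda * ((Tmap (r + flip r))^-1%VF x : dual A) y in
     let P : 'End(A) := (Tmap r \o sharp omega)%VF in
     is_quadratic_rota_baxter lambda succ prec P omega)
  /\
  (forall (P : 'End(A)) (omega : A -> A -> k),
     is_quadratic_rota_baxter lambda succ prec P omega ->
     forall r : tensor A A,
       Tmap r = (P \o (sharp omega)^-1)%VF ->
       is_factorizable succ prec r).
Proof.
move=> lambda0; split=> [r fact omega P|P omega qrb r rP].
  exact: quadratic_rota_baxter_of_factorizable.
exact: factorizable_of_quadratic_rota_baxter qrb rP.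
Qed.
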